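(* Let $\mathcal{M}=\{(\mathbf{M}^{(\lambda)})_{\lambda>0}\}$ and $\mathcal{N}=\{(\mathbf{N}^{(\lambda)})_{\lambda>0}\}$ be two weight matrices (indexed by multi-indices in $\mathbb{N}_0^d$) and assume that $\mathcal{M}$ is log-convex. Then the following characterizations hold: (i) Let $\mathcal{M}$ satisfy (R1), (R2) and (R3), and let $\mathcal{N}$ satisfy (R1) and (R2). Then $\mathcal{S}_{\{\mathcal{M}\}}(\mathbb{R}^d)\subseteq\mathcal{S}_{\{\mathcal{N}\}}(\mathbb{R}^d)$ holds with continuous inclusion if and only if $\mathcal{M}\{\preceq\}\mathcal{N}$. (ii) Let $\mathcal{M}$ satisfy (R1), (R2) and (R3), and let $\mathcal{N}$ satisfy (B1) and (B2). Then $\mathcal{S}_{\{\mathcal{M}\}}(\mathbb{R}^d)\subseteq\mathcal{S}_{(\mathcal{N})}(\mathbb{R}^d)$ holds with continuous inclusion if and only if $\mathcal{M}\vartriangleleft\mathcal{N}$. (iii) Let $\mathcal{M}$ satisfy (B1), (B2) and (B3), and let $\mathcal{N}$ satisfy (B1) and (B2). Then $\mathcal{S}_{(\mathcal{M})}(\mathbb{R}^d)\subseteq\mathcal{S}_{(\mathcal{N})}(\mathbb{R}^d)$ holds with continuous inclusion if and only if $\mathcal{M}(\preceq)\mathcal{N}$. Here the conditions (R1)–(R3), (B1)–(B3), the relations $\{\preceq\}$, $\vartriangleleft$, $(\preceq)$ and the spaces are those defined in the context.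
   Context: $\mathbb{N}_0=\mathbb{N}\cup\{0\}$; for $\alpha\in\mathbb{N}_0^d$, $|\alpha|=\alpha_1+\cdots+\alpha_d$, $\alpha^{\alpha/2}=\prod_{j=1}^d\alpha_j^{\alpha_j/2}$ with $0^0:=1$; $e_j$ is the $j$-th canonical basis vector of $\mathbb{R}^d$; $\|\cdot\|_\infty$ is the supremum norm on $\mathbb{R}^d$. Weight matrix: a family $\mathcal{M}=\{(\mathbf{M}^{(\lambda)})_{\lambda>0}\}$ where each $\mathbf{M}^{(\lambda)}=(M^{(\lambda)}_\alpha)_{\alpha\in\mathbb{N}_0^d}$ is a sequence of positive real numbers with $M_0^{(\lambda)}=1$, and $M_\alpha^{(\lambda)}\le M_\alpha^{(\kappa)}$ for all $\alpha\in\mathbb{N}_0^d$ and all $0<\lambda\le\kappa$. It is log-convex if for every $\lambda>0$ there is a convex function $F_\lambda:[0,+\infty)^d\to\mathbb{R}$ with $F_\lambda(\alpha)=\log M^{(\lambda)}_\alpha$ for all $\alpha\in\mathbb{N}_0^d$. Spaces. For $\lambda,h>0$ and $f\in C^\infty(\mathbb{R}^d)$ put $$\|f\|_{\mathbf{M}^{(\lambda)},h}:=\sup_{\alpha,\beta\in\mathbb{N}_0^d}\frac{\|x^\alpha\partial^\beta f\|_\infty}{h^{|\alpha+\beta|}M^{(\lambda)}_{\alpha+\beta}}.$$ The Roumieu space is $\mathcal{S}_{\{\mathcal{M}\}}(\mathbb{R}^d):=\{f\in C^\infty(\mathbb{R}^d):\ \exists\lambda,h>0,\ \|f\|_{\mathbf{M}^{(\lambda)},h}<+\infty\}$,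 endowed with the inductive limit topology (over $\lambda,h$) of the normed spaces $\{f\in C^\infty(\mathbb{R}^d):\|f\|_{\mathbf{M}^{(\lambda)},h}<+\infty\}$. The Beurling space is $\mathcal{S}_{(\mathcal{M})}(\mathbb{R}^d):=\{f\in C^\infty(\mathbb{R}^d):\ \forall\lambda,h>0,\ \|f\|_{\mathbf{M}^{(\lambda)},h}<+\infty\}$, endowed with the projective limit topology of the same normed spaces (i.e. the topology given by all the seminorms $\|\cdot\|_{\mathbf{M}^{(\lambda)},h}$). Relations between weight matrices: - $\mathcal{M}\{\preceq\}\mathcal{N}$ if $\forall\lambda>0\ \exists\kappa>0\ \exists C\ge1$ such that $M_\alpha^{(\lambda)}\le C^{|\alpha|}N_\alpha^{(\kappa)}$ for all $\alpha\in\mathbb{N}_0^d$. - $\mathcal{M}(\preceq)\mathcal{N}$ if $\forall\lambda>0\ \exists\kappa>0\ \exists C\ge1$ such that $M_\alpha^{(\kappa)}\le C^{|\alpha|}N_\alpha^{(\lambda)}$ for all $\alpha\in\mathbb{N}_0^d$. - $\mathcal{M}\vartriangleleft\mathcal{N}$ if $\forall\lambda>0\ \forall\kappa>0\ \forall h>0\ \exists C\ge1$ such that $M_\alpha^{(\lambda)}\le Ch^{|\alpha|}N_\alpha^{(\kappa)}$ for all $\alpha\in\mathbb{N}_0^d$. Conditions on a weight matrix $\mathcal{M}$, Roumieu type: - (R1) $\forall\lambda>0\ \exists\kappa\ge\lambda,\ B,C,H>0$: $\alpha^{\alpha/2}M_\beta^{(\lambda)}\le BC^{|\alpha|}H^{|\alpha+\beta|}M_{\alpha+\beta}^{(\kappa)}$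 for all $\alpha,\beta\in\mathbb{N}_0^d$. - (R2) $\forall\lambda>0\ \exists\kappa\ge\lambda,\ A\ge1$: $M_{\alpha+e_j}^{(\lambda)}\le A^{|\alpha|+1}M_\alpha^{(\kappa)}$ for all $\alpha\in\mathbb{N}_0^d$, $1\le j\le d$. - (R3) $\forall\lambda>0\ \exists\kappa\ge\lambda,\ A\ge1$: $M_\alpha^{(\lambda)}M_\beta^{(\lambda)}\le A^{|\alpha+\beta|}M_{\alpha+\beta}^{(\kappa)}$ for all $\alpha,\beta\in\mathbb{N}_0^d$. Beurling type: - (B1) $\forall\lambda>0\ \exists\,0<\kappa\le\lambda,\ H>0$ such that $\forall C>0\ \exists B>0$: $\alpha^{\alpha/2}M_\beta^{(\kappa)}\le BC^{|\alpha|}H^{|\alpha+\beta|}M_{\alpha+\beta}^{(\lambda)}$ for all $\alpha,\beta\in\mathbb{N}_0^d$. - (B2) $\forall\lambda>0\ \exists\,0<\kappa\le\lambda,\ A\ge1$: $M_{\alpha+e_j}^{(\kappa)}\le A^{|\alpha|+1}M_\alpha^{(\lambda)}$ for all $\alpha\in\mathbb{N}_0^d$, $1\le j\le d$. - (B3) $\forall\lambda>0\ \exists\,0<\kappa\le\lambda,\ A\ge1$: $M_\alpha^{(\kappa)}M_\beta^{(\kappa)}\le A^{|\alpha+\beta|}M_{\alpha+\beta}^{(\lambda)}$ for all $\alpha,\beta\in\mathbb{N}_0^d$. *)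

(* Defs.v *)
From HB Require Import structures.
From mathcomp Require Import all_boot all_order all_algebra.
From mathcomp Require Import complex.
From mathcomp Require Import all_classical all_reals all_analysis.

Set Implicit Arguments.
Unset Strict Implicit.
Unset Printing Implicit Defensive.

Import Order.TTheory GRing.Theory Num.Theory.
Import numFieldNormedType.Exports.

Local Open Scope classical_set_scope.
Local Open Scope ring_scope.

(* Multi-indices are row vectors of natural numbers, so that addition is
   componentwise and e_j is [delta_mx 0 j]. *)
Notation mindex d := ('rV[nat]_d) (only parsing).

Definition mlength d (a : mindex d) : nat := (\sum_j a 0%R j)%N.

(* [powR] satisfies 0 `^ 0 = 1. *)
Definition mhalfpow (R : realType) d (a : mindex d) : R :=
  \prod_j ((a 0 j)%:R `^ ((a 0 j)%:R / 2)).

Section weight_matrices.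
Context {R : realType} {d : nat}.
Implicit Types (M N : R -> mindex d -> R) (a b : mindex d) (j : 'I_d).
Implicit Types (l k h A B C H : R).

(* Only the values at positive parameters matter. *)
Definition weight_matrix M :=
  [/\ forall l a, 0 < l -> 0 < M l a,
      forall l, 0 < l -> M l 0 = 1
    & forall l k a, 0 < l -> l <= k -> M l a <= M k a].

Definition log_convex M :=
  forall l, 0 < l -> exists F : 'rV[R]_d -> R,
    convex_function [set x : 'rV[R]_d | forall j, 0 <= x 0 j] F /\
    forall a : mindex d, F (\row_j (a 0 j)%:R) = ln (M l a).

Definition prec_roumieu M N :=
  forall l, 0 < l -> exists k C, [/\ 0 < k, 1 <= C
    & forall a, M l a <= C ^+ mlength a * N k a].

Definition prec_beurling M N :=
  forall l, 0 < l -> exists k C, [/\ 0 < k, 1 <= C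
    & forall a, M k a <= C ^+ mlength a * N l a].

Definition triangle_prec M N :=
  forall l k h, 0 < l -> 0 < k -> 0 < h -> exists2 C : R, 1 <= C
    & forall a, M l a <= C * h ^+ mlength a * N k a.

Definition R1 M :=
  forall l, 0 < l -> exists k B C H, [/\ l <= k, 0 < B, 0 < C, 0 < H
    & forall a b, mhalfpow R a * M l b <=
        B * C ^+ mlength a * H ^+ mlength (a + b) * M k (a + b)].

Definition R2 M :=
  forall l, 0 < l -> exists k A, [/\ l <= k, 1 <= A
    & forall a j, M l (a + delta_mx 0 j) <= A ^+ (mlength a).+1 * M k a].

Definition R3 M :=
  forall l, 0 < l -> exists k A, [/\ l <= k, 1 <= A
    & forall a b, M l a * M l b <= A ^+ mlength (a + b) * M k (a + b)].

Definition B1 M :=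
  forall l, 0 < l -> exists k H, [/\ 0 < k, k <= l, 0 < H
    & forall C, 0 < C -> exists2 B : R, 0 < B
    & forall a b, mhalfpow R a * M k b <=
        B * C ^+ mlength a * H ^+ mlength (a + b) * M l (a + b)].

Definition B2 M :=
  forall l, 0 < l -> exists k A, [/\ 0 < k, k <= l, 1 <= A
    & forall a j, M k (a + delta_mx 0 j) <= A ^+ (mlength a).+1 * M l a].

Definition B3 M :=
  forall l, 0 < l -> exists k A, [/\ 0 < k, k <= l, 1 <= A
    & forall a b, M k a * M k b <= A ^+ mlength (a + b) * M l (a + b)].

End weight_matrices.

Section smooth_functions.
Context {R : realType} {d : nat}.
Implicit Types (g : 'rV[R]_d -> R) (f : 'rV[R]_d -> R[i]).
Implicit Types (j : 'I_d) (x : 'rV[R]_d) (l h : R).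

Definition pderiv (j : 'I_d) g : 'rV[R]_d -> R := fun x => 'D_(delta_mx 0 j) g x.

Definition pderivs (s : seq 'I_d) g := foldr pderiv g s.

(* All iterated partial derivatives, in any order, exist and are continuous. *)
Definition smooth_real g := forall s : seq 'I_d,
  continuous (pderivs s g) /\
  forall j x, derivable (pderivs s g) x (delta_mx 0 j).

(* R[i] carries no normed R-module structure in the library; a complex-valued
   function of real variables is differentiated through its real and imaginary
   parts. *)
Definition smooth f :=
  smooth_real (fun x => complex.Re (f x)) /\
  smooth_real (fun x => complex.Im (f x)).

Definition mderiv_real (b : mindex d) g :=
  pderivs (flatten [seq nseq (b 0 j) j | j <- enum 'I_d]) g.

Definition mderiv (b : mindex d) f : 'rV[R]_d -> R[i] := fun x =>
  Complex (mderiv_real b (fun y => complex.Re (f y)) x)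
          (mderiv_real b (fun y => complex.Im (f y)) x).

Definition monomial (a : mindex d) (x : 'rV[R]_d) : R := \prod_j x 0 j ^+ a 0 j.

Definition supnorm f : \bar R :=
  ereal_sup (range (fun x => (ComplexField.Normc.normc (f x))%:E)).

Definition wnorm (M : R -> mindex d -> R) (l h : R) f : \bar R :=
  ereal_sup (range (fun ab : mindex d * mindex d =>
    (supnorm (fun x => real_complex R (monomial ab.1 x) * mderiv ab.2 f x)%R
     * ((h ^+ mlength (ab.1 + ab.2) * M l (ab.1 + ab.2))^-1)%R%:E)%E)).

Definition step (M : R -> mindex d -> R) (l h : R) : set ('rV[R]_d -> R[i]) :=
  [set f | smooth f /\ (wnorm M l h f < +oo)%E].

Definition roumieu (M : R -> mindex d -> R) : set ('rV[R]_d -> R[i]) :=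
  [set f | smooth f /\
    exists l h, [/\ 0 < l, 0 < h & (wnorm M l h f < +oo)%E]].

Definition beurling (M : R -> mindex d -> R) : set ('rV[R]_d -> R[i]) :=
  [set f | smooth f /\
    forall l h, 0 < l -> 0 < h -> (wnorm M l h f < +oo)%E].

Definition absolutely_convex (V : set ('rV[R]_d -> R[i])) :=
  forall (f g : 'rV[R]_d -> R[i]) (a b : R[i]), V f -> V g ->
    ComplexField.Normc.normc a + ComplexField.Normc.normc b <= 1 ->
    V (fun x => a * f x + b * g x).

End smooth_functions.

Record roumieu_space (R : realType) d (M : R -> mindex d -> R) := RoumieuSpace {
  roumieu_fun :> 'rV[R]_d -> R[i];
  roumieuP : roumieu M roumieu_fun }.

Record beurling_space (R : realType) d (M : R -> mindex d -> R) := BeurlingSpace {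
  beurling_fun :> 'rV[R]_d -> R[i];
  beurlingP : beurling M beurling_fun }.

HB.instance Definition _ (R : realType) d (M : R -> mindex d -> R) :=
  gen_eqMixin (roumieu_space M).
HB.instance Definition _ (R : realType) d (M : R -> mindex d -> R) :=
  gen_choiceMixin (roumieu_space M).
HB.instance Definition _ (R : realType) d (M : R -> mindex d -> R) :=
  gen_eqMixin (beurling_space M).
HB.instance Definition _ (R : realType) d (M : R -> mindex d -> R) :=
  gen_choiceMixin (beurling_space M).

Section roumieu_topology.
Context {R : realType} {d : nat} (M : R -> mindex d -> R).
Implicit Types (l h e : R) (p : R * R).

(* 0-neighborhoods of the locally convex inductive limit: absolutely convex sets
   meeting every step in a 0-neighborhood of that normed space. Here V may
   exceed the Roumieu space: only its trace matters, and that trace is again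
   absolutely convex because the Roumieu space is a linear subspace. *)
Definition indlim_nbhs0 (V : set ('rV[R]_d -> R[i])) :=
  absolutely_convex V /\
  forall l h, 0 < l -> 0 < h -> exists2 e : R, 0 < e
    & forall g : 'rV[R]_d -> R[i], step M l h g -> (wnorm M l h g < e%:E)%E -> V g.

Definition roumieu_open : set_system (roumieu_space M) :=
  [set U | forall f : roumieu_space M, U f -> exists2 V, indlim_nbhs0 V
    & forall g : roumieu_space M, V (fun x => g x - f x) -> U g].

Lemma roumieu_openT : roumieu_open setT.
Proof.
move=> f _; exists setT => //; split; first by [].
by move=> l h _ _; exists 1.
Qed.

Lemma roumieu_openI : setI_closed roumieu_open.
Proof.
move=> U1 U2 o1 o2 f [/o1[V1 [c1 n1] s1] /o2[V2 [c2 n2] s2]].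
exists (V1 `&` V2) => [|g [/s1 ? /s2 ?]]; last by [].
split=> [u v a b [? ?] [? ?] ab|l h l0 h0]; first by split; [apply: c1|apply: c2].
have [e1 e10 n1'] := n1 _ _ l0 h0; have [e2 e20 n2'] := n2 _ _ l0 h0.
exists (Num.min e1 e2) => [|g sg]; first by rewrite lt_min e10.
rewrite EFin_min lt_min => /andP[? ?].
by split; [exact: n1'|exact: n2'].
Qed.

Lemma roumieu_open_bigU (I : Type) (U : I -> set (roumieu_space M)) :
  (forall i, roumieu_open (U i)) -> roumieu_open (\bigcup_i U i).
Proof.
move=> oU f [i _ /(oU i)[V nV sV]]; exists V => // g /sV Ug; by exists i.
Qed.

End roumieu_topology.

HB.instance Definition _ (R : realType) d (M : R -> mindex d -> R) :=
  isOpenTopological.Build (roumieu_space M)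
    (@roumieu_openT R d M) (@roumieu_openI R d M) (@roumieu_open_bigU R d M).

Section beurling_topology.
Context {R : realType} {d : nat} (M : R -> mindex d -> R).
Implicit Types (l h e : R) (p : R * R).

(* The topology generated by all the seminorms [wnorm M l h]: s lists the
   finitely many parameters (l, h) involved in a basic neighborhood. *)
Definition beurling_open : set_system (beurling_space M) :=
  [set U | forall f : beurling_space M, U f ->
    exists s : seq (R * R), exists2 e : R, 0 < e
    & (forall p, p \in s -> 0 < p.1 /\ 0 < p.2) /\
      forall g : beurling_space M,
        (forall p, p \in s ->
          (wnorm M p.1 p.2 (fun x => g x - f x)%R < e%:E)%E) -> U g].

Lemma beurling_openT : beurling_open setT.
Proof. by move=> f _; exists [::], 1. Qed.

Lemma beurling_openI : setI_closed beurling_open.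
Proof.
move=> U1 U2 o1 o2 f [/o1[t1 [e1 e10 [p1 s1]]] /o2[t2 [e2 e20 [p2 s2]]]].
exists (t1 ++ t2), (Num.min e1 e2); first by rewrite lt_min e10.
split=> [p|g gs].
  by rewrite mem_cat => /orP[/p1|/p2].
split; [apply: s1|apply: s2] => p ps.
  have := gs p; rewrite mem_cat ps => /(_ isT).
  by rewrite EFin_min lt_min => /andP[].
have := gs p; rewrite mem_cat ps orbT => /(_ isT).
by rewrite EFin_min lt_min => /andP[].
Qed.

Lemma beurling_open_bigU (I : Type) (U : I -> set (beurling_space M)) :
  (forall i, beurling_open (U i)) -> beurling_open (\bigcup_i U i).
Proof.
move=> oU f [i _ /(oU i)[s [e e0 [ps sU]]]]; exists s, e => //; split=> // g /sU.
by move=> Ug; exists i.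
Qed.

End beurling_topology.

HB.instance Definition _ (R : realType) d (M : R -> mindex d -> R) :=
  isOpenTopological.Build (beurling_space M)
    (@beurling_openT R d M) (@beurling_openI R d M) (@beurling_open_bigU R d M).

(* Main.v *)
Require Import Defs.
From mathcomp Require Import all_boot all_order all_algebra.
From mathcomp Require Import complex zify ring lra.
From mathcomp Require Import all_classical all_reals all_analysis.
Set Implicit Arguments.
Unset Strict Implicit.
Unset Printing Implicit Defensive.
Import Order.TTheory GRing.Theory Num.Theory.
Import numFieldNormedType.Exports.
Local Open Scope classical_set_scope.
Local Open Scope ring_scope.

(** If the weights are comparable then so are the suprema defining the norms,
which gives the continuous inclusions ([prec_roumieu_continuous],
[triangle_prec_continuous], [prec_beurling_continuous]).

For the converse implications the inclusion is tested on multiples of the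
translated Gaussians g_t(x) = exp (- |x - t|^2 / 2), where t has nonnegative
coordinates.

They are easy to bound from below: at x = t the monomial x^a contributes
t^a g_t(t) = t^a, so a bound on the norm of c g_t for the weights N yields
c t^a <= r h^|a| N_a ([wnorm_lower]).

They are also controlled from above: in each coordinate either |x_j| is at most
2 t_j, and the power of x_j is paid for by a power of t_j, or |x_j| is at most
2 |x_j - t_j|, and it is paid for by the decay of the Gaussian.  As the
derivatives of exp (- y^2 / 2) are Hermite polynomials times exp (- y^2 / 2),
this gives, for some splitting a = a1 + a2 depending on x,

  |x^a D^b g_t(x)| <= 2^|a+b| (a2+b)^((a2+b)/2) t^a1    ([tgauss_le]).

If c t^e <= C^|e| M_e for all e, then (R1) or (B1) turns the product of
(a2+b)^((a2+b)/2) and c t^a1 into a multiple of (2CH)^|a+b| M_(a+b), that is, it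
bounds the norm of c g_t for the weights M ([wnorm_cgauss_le]).

Log-convexity says that these two bounds can be sharp together: for every a, a
subgradient of log M at a provides t and c with c t^e <= C^|e| M_e for all e
and equality at e = a ([log_convex_gauss]).  A neighborhood of 0 given by the
continuity of the inclusion contains all these functions after multiplication
by one and the same e > 0, so e C^|a| M_a is at most a bound which only involves N.

It remains to choose the neighborhoods in the space for N.  In a Beurling space
one seminorm is enough.  In a Roumieu space, if M^(l) were dominated by
X^|.| N^(k) for no k and X, pick for each n an index a_n at which this fails
with k = n and X of order n^2, and let t_n be the corresponding point; the conditions
|t_n^a_n f(t_n)| <= n^|a_n| N^(n)_(a_n) for all n define a neighborhood of 0 in
the inductive limit, because on a given step all but finitely many of them
follow from the size of the norm ([indlim_nbhs0_polar]). *)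

(** * Hermite polynomials and the derivatives of the Gaussian *)

Section hermite.
Variable R : realType.
Implicit Types (t x y : R) (n m N : nat).

(** The polynomial [hermite n] is the quotient of the n-th derivative of
exp (- y^2 / 2) by exp (- y^2 / 2): up to the sign (-1)^n, the probabilists'
Hermite polynomial. *)
Fixpoint hermite n : {poly R} :=
  if n is n'.+1 then (hermite n')^`() - 'X * hermite n' else 1.

Lemma hermiteS n : hermite n.+1 = (hermite n)^`() - 'X * hermite n.
Proof. by []. Qed.

Lemma deriv_hermite n : (hermite n.+1)^`() = - (hermite n *+ n.+1).
Proof.
elim: n => [|n IHn]; first by rewrite /= derivB derivM derivX derivC; ring.
rewrite hermiteS derivB derivM derivX mul1r IHn derivN derivMn.
have -> : (hermite n)^`() = hermite n.+1 + 'X * hermite n by rewrite hermiteS subrK.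
move: (hermite n.+1) (hermite n) 'X => u v X.
rewrite mulrN mulrnAr mulrnDl [in RHS]mulrSr; move: (u *+ n.+1) (X * v *+ n.+1) => a b.
ring.
Qed.

(** The usual recurrence, free of derivatives. *)
Lemma hermiteSS n :
  hermite n.+2 = - ('X * hermite n.+1) - hermite n *+ n.+1.
Proof. by rewrite -deriv_hermite addrC. Qed.

Definition gauss y := expR (- (y ^+ 2 / 2)).

Lemma gauss_ge0 y : 0 <= gauss y. Proof. exact: expR_ge0. Qed.

(** The m-th power of the inequality y^2 / m <= exp (y^2 / m). *)
Lemma expr_gauss_le m y : `|y| ^+ m * gauss y <= Num.sqrt m%:R ^+ m.
Proof.
have h : (y ^+ 2) ^+ m <= m%:R ^+ m * expR (y ^+ 2).
  case: m => [|m]; first by rewrite !expr0 mul1r -expR0 ler_expR sqr_ge0.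
  have {2}-> : y ^+ 2 = m.+1%:R * (y ^+ 2 / m.+1%:R) by rewrite mulrC divfK.
  rewrite expRM_natl -exprMn lerXn2r ?nnegrE ?sqr_ge0 ?mulr_ge0 ?expR_ge0//.
  rewrite mulrC -ler_pdivrMr//.
  by apply: le_trans (expR_ge1Dx _); rewrite lerDr.
rewrite -ler_sqr ?nnegrE ?mulr_ge0 ?gauss_ge0 ?exprn_ge0 ?sqrtr_ge0//.
rewrite exprMn -!exprM [(m * 2)%N]mulnC !exprM sqr_sqrtr// real_normK ?num_real//.
rewrite /gauss -expRM_natl -ler_pdivlMr ?expR_gt0// -expRN.
by congr (_ <= _ * expR _) : h; field.
Qed.

(** The three-term recurrence trades one power of y for one order of
derivation, while the factor n of its last term is absorbed by sqrt(N)^2; this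
is why the exponent of sqrt(N) is m + n, with N fixed during the induction. *)
Lemma hermite_gauss_le n m N y : (m + n <= N)%N ->
  `|y| ^+ m * `|(hermite n).[y]| * gauss y <= 2 ^+ n * Num.sqrt N%:R ^+ (m + n).
Proof.
have rN : (Num.sqrt N%:R ^+ 2 = N%:R :> R) by rewrite sqr_sqrtr.
elim/ltn_ind: n m => -[|n] IHn m mnN.
  rewrite addn0 hornerC normr1 mulr1 expr0 mul1r (le_trans (expr_gauss_le _ _))//.
  rewrite lerXn2r ?nnegrE ?sqrtr_ge0// ler_sqrt ?ler0n// ler_nat.
  by rewrite -[m]addn0.
have hX : `|y| ^+ m * `|y * (hermite n).[y]| * gauss y <=
    2 ^+ n * Num.sqrt N%:R ^+ (m + n.+1).
  rewrite normrM mulrA -exprSr -addSnnS IHn//; by rewrite addSnnS.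
case: n IHn mnN hX => [|n] IHn mnN hX.
  rewrite hermiteS derivC sub0r hornerN normrN hornerM hornerX.
  apply: le_trans hX _; rewrite ler_wpM2r ?exprn_ge0 ?sqrtr_ge0//.
  by rewrite expr0 expr1 ler1n.
have hn : `|y| ^+ m * `|(hermite n).[y] *+ n.+1| * gauss y <=
    2 ^+ n.+1 * Num.sqrt N%:R ^+ (m + n.+2).
  have := IHn n (ltnW (ltnSn _)) m.
  have mnN' : (m + n <= N)%N by lia.
  move=> /(_ mnN') h.
  rewrite normrMn -[X in _ * X * _]mulr_natr mulrA mulrAC.
  have -> : (m + n.+2 = (m + n) + 2)%N by rewrite addn2 !addnS.
  rewrite exprD rN mulrA ler_pM ?mulr_ge0 ?exprn_ge0 ?gauss_ge0//; last first.
    by rewrite ler_nat; lia.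
  apply: le_trans h _; rewrite ler_wpM2r ?exprn_ge0 ?sqrtr_ge0//.
  by rewrite ler_weXn2l// ler1n.
rewrite hermiteSS hornerD !hornerN hornerM hornerX hornerMn.
rewrite [X in _ <= X * _]exprS [X in _ <= X * _]mulr_natl mulr2n mulrDl.
apply: le_trans (lerD hX hn).
rewrite -mulrDl -mulrDr ler_wpM2r ?gauss_ge0// ler_wpM2l ?exprn_ge0//.
by rewrite -opprD normrN ler_normD.
Qed.

Lemma is_derive_gauss y : is_derive y 1 gauss (- y * gauss y).
Proof.
have E : gauss = expR \o horner (- (2^-1 *: 'X^2)).
  by apply/funext => z /=; rewrite hornerN hornerZ hornerXn mulrC.
rewrite {1}E; apply: is_derive_eq.
rewrite derivN derivZ derivXn !hornerN !hornerZ hornerMn !hornerXn.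
rewrite mulrC /gauss; congr (_ * expR _); last by rewrite mulrC.
by rewrite /= -mulr_natr; field.
Qed.

Definition gauss_der t n y := (hermite n).[y - t] * gauss (y - t).

Lemma is_derive_gauss_der t n y :
  is_derive y 1 (gauss_der t n) (gauss_der t n.+1 y).
Proof.
have hs : is_derive y 1 (fun z : R => z - t) 1.
  by apply: is_derive_eq; rewrite ?subr0// oppr0 addr0.
have hp : is_derive y 1 (fun z : R => (hermite n).[z - t]) (hermite n)^`().[y - t].
  have := @is_derive1_comp _ (horner (hermite n)) (fun z => z - t) y.
  by move=> /(_ _ _ (is_derive_poly _ _) hs); rewrite mulr1.
have hg : is_derive y 1 (fun z : R => gauss (z - t)) (- (y - t) * gauss (y - t)).
  have := @is_derive1_comp _ gauss (fun z => z - t) y.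
  by move=> /(_ _ _ (is_derive_gauss _) hs); rewrite mulr1.
rewrite /gauss_der hermiteS hornerD hornerN hornerM hornerX.
apply: (is_derive_eq (is_deriveM hp hg)).
by rewrite /GRing.scale/=; ring.
Qed.

End hermite.

(** * Translated Gaussians in several variables *)

Lemma halfpowE (R : realType) n : (n%:R : R) `^ (n%:R / 2) = Num.sqrt n%:R ^+ n.
Proof. by rewrite mulrC powRrM powR12_sqrt// powR_mulrn// sqrtr_ge0. Qed.

(** Either |x| <= 2 t, and x^a is bounded by (2 t)^a, or |x| <= 2 |x - t|, and
x^a is absorbed into the decay at infinity. *)
Lemma gauss_der_le (R : realType) (t x : R) (a b : nat) : 0 <= t ->
  `|x ^+ a * gauss_der t b x| <=
  2 ^+ (a + b) * (if `|x - t| < t then Num.sqrt b%:R ^+ b * t ^+ a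
                  else Num.sqrt (a + b)%:R ^+ (a + b)).
Proof.
move=> t0; rewrite normrM normrX /gauss_der normrM (ger0_norm (gauss_ge0 _)).
have xt : `|x| <= `|x - t| + t.
  by rewrite -{1}[x](subrK t) (le_trans (ler_normD _ _))// lerD2l ger0_norm.
rewrite mulrA; case: ltP => xtt.
  have := @hermite_gauss_le R b 0 b (x - t) (leqnn _).
  rewrite expr0 mul1r add0n => h.
  have -> : 2 ^+ (a + b) * (Num.sqrt b%:R ^+ b * t ^+ a) =
      (2 * t) ^+ a * (2 ^+ b * Num.sqrt b%:R ^+ b) by rewrite exprD exprMn; ring.
  rewrite -mulrA; apply: ler_pM; rewrite ?mulr_ge0 ?exprn_ge0 ?gauss_ge0//.
  rewrite lerXn2r ?nnegrE ?mulr_ge0// (le_trans xt)//.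
  by rewrite mulr_natl mulr2n lerD2r ltW.
have := @hermite_gauss_le R b a (a + b) (x - t) (leqnn _) => h.
rewrite exprD -[leRHS]mulrA; apply: le_trans (ler_wpM2l _ h); last exact: exprn_ge0.
rewrite !mulrA -exprMn; do 2 (apply: ler_wpM2r; rewrite ?gauss_ge0//).
rewrite lerXn2r ?nnegrE ?mulr_ge0// (le_trans xt)//.
by rewrite mulr_natl mulr2n lerD2l.
Qed.

Section translated_gaussian.
Variables (R : realType) (d : nat).
Implicit Types (t x : 'rV[R]_d) (a b n : 'rV[nat]_d).

Definition tgauss t n x : R := \prod_j gauss_der (t 0 j) (n 0 j) (x 0 j).

Lemma mlengthD a b : mlength (a + b) = (mlength a + mlength b)%N.
Proof. by rewrite /mlength -big_split; apply: eq_bigr => j _; rewrite mxE. Qed.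

Lemma expr_mlength (h : R) a : h ^+ mlength a = \prod_j h ^+ a 0 j.
Proof. by rewrite /mlength expr_sum. Qed.

(** The exponent a is split as a1 + a2, coordinate by coordinate according to
the two cases of [gauss_der_le]; the splitting depends on x. *)
Lemma tgauss_le t a b x : (forall j, 0 <= t 0 j) ->
  exists a1 a2 : 'rV[nat]_d, a = a1 + a2 /\
    `|monomial a x * tgauss t b x| <=
       2 ^+ mlength (a + b) * mhalfpow R (a2 + b) * monomial a1 t.
Proof.
move=> t0; pose near j := `|x 0 j - t 0 j| < t 0 j.
exists (\row_j (if near j then a 0 j else 0%N)).
exists (\row_j (if near j then 0%N else a 0 j)); split.
  by apply/rowP => j; rewrite !mxE; case: ifP; rewrite ?addr0 ?add0r.
rewrite expr_mlength /mhalfpow /monomial /tgauss -!big_split/= normr_prod.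
apply: ler_prod => j _; rewrite normr_ge0/=.
apply: le_trans (gauss_der_le _ _ _ (t0 j)) _; rewrite !mxE halfpowE -mulrA.
by rewrite -/(near j); case: ifP => _; rewrite ?expr0 ?mulr1 ?add0n.
Qed.

(** Reduces a directional derivative to one in dimension one when g is, along
the line through x, a multiple of a function of one variable. *)
Lemma is_derive_line (g : 'rV[R]_d -> R) (u : R -> R) (K du : R) (v x : 'rV[R]_d) (y : R) :
  is_derive y 1 u du -> (forall h, g (h *: v + x) = K * u (h + y)) ->
  is_derive x v g (K * du).
Proof.
move=> [du1 du2] gu.
have E : (fun h => h^-1 *: ((g \o shift x) (h *: v) - g x)) =
    (fun h => K *: (h^-1 *: ((u \o shift y) (h *: 1) - u y))).
  apply/funext => h /=; rewrite gu -[X in g X]add0r -[0](scale0r v) gu add0r.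
  by rewrite /GRing.scale/= mulr1; ring.
have c : (fun h => h^-1 *: ((g \o shift x) (h *: v) - g x)) @ 0^' --> K * du.
  rewrite E; apply: cvgMl_tmp.
  rewrite -du2; exact: du1.
split; first by apply/cvg_ex; exists (K * du).
exact: cvg_lim c.
Qed.

Lemma is_derive_tgauss t n x c j :
  is_derive x (delta_mx 0 j) (fun y => c * tgauss t n y)
    (c * tgauss t (n + delta_mx 0 j) x).
Proof.
rewrite /tgauss (bigD1 j)//= mulrCA mulrC.
apply: (is_derive_eq (is_derive_line (is_derive_gauss_der (t 0 j) (n 0 j) (x 0 j)) _)).
  move=> h; rewrite (bigD1 j)//= mulrCA mulrC !mxE !eqxx mulr1.
  congr (c * _ * _); apply: eq_bigr => k kj.
  by rewrite !mxE (negPf kj) andbF mulr0 add0r.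
have -> : (n + delta_mx 0 j) 0 j = (n 0 j).+1 by rewrite !mxE !eqxx; exact: addn1.
congr (c * _ * _); apply: eq_bigr => k kj.
by rewrite !mxE (negPf kj) andbF addr0.
Qed.

Lemma continuous_tgauss t n c : continuous (fun y => c * tgauss t n y).
Proof.
move=> x; apply: continuousM; first exact: cst_continuous.
have h : forall j, continuous (fun y : 'rV[R]_d => gauss_der (t 0 j) (n 0 j) (y 0 j)).
  move=> j {}x.
  apply: (@continuous_comp _ _ _ (fun y : 'rV[R]_d => y 0 j) (gauss_der (t 0 j) (n 0 j))).
    exact: coord_continuous.
  apply: differentiable_continuous; apply/derivable1_diffP.
  by have [] := is_derive_gauss_der (t 0 j) (n 0 j) (x 0 j).
apply: (@continuous_big R _ *%R 1 predT _ _ _ _ (fun j _ => h j)).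
exact: (@mul_continuous R).
Qed.

End translated_gaussian.

(** * Smooth functions, their derivatives and the norms *)

Section derivatives.
Variables (R : realType) (d : nat).
Implicit Types (t x : 'rV[R]_d) (a b n : 'rV[nat]_d) (g : 'rV[R]_d -> R).
Implicit Types (f : 'rV[R]_d -> R[i]).
Local Notation normc := (@ComplexField.Normc.normc R).

Lemma pderivs_tgauss s c t n : pderivs s (fun y => c * tgauss t n y) =
  (fun y => c * tgauss t (n + \sum_(j <- s) delta_mx 0 j) y).
Proof.
elim: s => [|j s IHs] /=; first by rewrite big_nil addr0.
rewrite IHs; apply/funext => x; rewrite big_cons [delta_mx 0 j + _]addrC addrA.
by have [_] := is_derive_tgauss t (n + \sum_(j <- s) delta_mx 0 j) x c j.
Qed.

Lemma smooth_real_tgauss c t n : smooth_real (fun y => c * tgauss t n y).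
Proof.
move=> s; rewrite pderivs_tgauss; split; first exact: continuous_tgauss.
by move=> j x; have [] := is_derive_tgauss t (n + \sum_(j <- s) delta_mx 0 j) x c j.
Qed.

Lemma mderiv_real_tgauss b c t :
  mderiv_real b (fun y => c * tgauss t 0 y) = (fun y => c * tgauss t b y).
Proof.
rewrite /mderiv_real pderivs_tgauss add0r big_flatten big_map big_enum/=.
suff -> : \sum_(j < d) \sum_(i <- nseq (b 0 j) j) delta_mx 0 i = b by [].
apply/rowP => k; rewrite summxE.
have E j : (\sum_(i <- nseq (b 0 j) j) delta_mx 0 i : 'rV[nat]_d) 0 k =
    if j == k then b 0 j else 0%N.
  rewrite big_nseq; elim: (b 0 j) => /= [|m IHm]; first by rewrite mxE if_same.
  by rewrite !mxE IHm [k == j]eq_sym eqxx; case: (j == k).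
by under eq_bigr do rewrite E; rewrite -big_mkcond big_pred1_eq.
Qed.

Lemma smooth_real_comb g1 g2 (p q : R) : smooth_real g1 -> smooth_real g2 ->
  (forall s, pderivs s (fun x => p * g1 x + q * g2 x) =
    (fun x => p * pderivs s g1 x + q * pderivs s g2 x)) /\
  smooth_real (fun x => p * g1 x + q * g2 x).
Proof.
move=> s1 s2.
have E s j x : is_derive x (delta_mx 0 j)
    (fun x => p * pderivs s g1 x + q * pderivs s g2 x)
    (p * pderivs (j :: s) g1 x + q * pderivs (j :: s) g2 x).
  have d1 : is_derive x (delta_mx 0 j) (pderivs s g1) (pderivs (j :: s) g1 x).
    by split => //; exact: (s1 s).2.
  have d2 : is_derive x (delta_mx 0 j) (pderivs s g2) (pderivs (j :: s) g2 x).
    by split => //; exact: (s2 s).2.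
  exact: (is_deriveD (is_deriveZ p d1) (is_deriveZ q d2)).
have D s : pderivs s (fun x => p * g1 x + q * g2 x) =
    (fun x => p * pderivs s g1 x + q * pderivs s g2 x).
  elim: s => [//|j s IHs] /=; rewrite IHs; apply/funext => x.
  by have [_] := E s j x.
split=> // s; rewrite D; split=> [|j x]; last by have [] := E s j x.
have cM q' g : continuous g -> continuous (fun x : 'rV[R]_d => q' * g x).
  by move=> cg x; apply: continuousM; [exact: cst_continuous|exact: cg].
by move=> x; exact: (continuousD (cM p _ (s1 s).1 x) (cM q _ (s2 s).1 x)).
Qed.

(** Complex linearity of the derivatives, which are defined through real and
imaginary parts; the norm balls are absolutely convex thanks to it. *)
Lemma smooth_comb f1 f2 (p q : R[i]) : smooth f1 -> smooth f2 ->
  (forall b x, mderiv b (fun x => p * f1 x + q * f2 x) x =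
     p * mderiv b f1 x + q * mderiv b f2 x) /\
  smooth (fun x => p * f1 x + q * f2 x).
Proof.
move=> [r1 i1] [r2 i2]; case: p q => [pr pi] [qr qi].
have [A1 B1] := smooth_real_comb pr (- pi) r1 i1.
have [A2 B2] := smooth_real_comb qr (- qi) r2 i2.
have [A3 B3] := smooth_real_comb pr pi i1 r1.
have [A4 B4] := smooth_real_comb qr qi i2 r2.
have [A5 B5] := smooth_real_comb 1 1 B1 B2.
have [A6 B6] := smooth_real_comb 1 1 B3 B4.
have E5 : (fun x => complex.Re ((pr +i* pi)%C * f1 x + (qr +i* qi)%C * f2 x)) =
   (fun x => 1 * (pr * complex.Re (f1 x) + - pi * complex.Im (f1 x)) +
             1 * (qr * complex.Re (f2 x) + - qi * complex.Im (f2 x))).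
  by apply/funext => x; case: (f1 x) (f2 x) => [u v] [w z] /=; ring.
have E6 : (fun x => complex.Im ((pr +i* pi)%C * f1 x + (qr +i* qi)%C * f2 x)) =
   (fun x => 1 * (pr * complex.Im (f1 x) + pi * complex.Re (f1 x)) +
             1 * (qr * complex.Im (f2 x) + qi * complex.Re (f2 x))).
  by apply/funext => x; case: (f1 x) (f2 x) => [u v] [w z] /=; ring.
split; last by split; rewrite ?E5 ?E6.
move=> b x; rewrite /mderiv E5 E6 /mderiv_real A5 A6 A1 A2 A3 A4.
by apply/eqP; rewrite eq_complex /=; apply/andP; split; apply/eqP; ring.
Qed.

Definition cgauss c t x : R[i] := real_complex R (c * tgauss t 0 x).

Lemma pderivs0 s : pderivs s (fun _ : 'rV[R]_d => 0 : R) = (fun _ => 0).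
Proof.
elim: s => //= j s ->; apply/funext => x; exact: derive_cst.
Qed.

Lemma smooth_real0 : smooth_real (fun _ : 'rV[R]_d => 0 : R).
Proof.
move=> s; rewrite pderivs0; split; first exact: cst_continuous.
by move=> j x; exact: derivable_cst.
Qed.

Lemma smooth_cgauss c t : smooth (cgauss c t).
Proof. by split; [exact: smooth_real_tgauss|exact: smooth_real0]. Qed.

Lemma mderiv_cgauss b c t x :
  mderiv b (cgauss c t) x = real_complex R (c * tgauss t b x).
Proof. by rewrite /mderiv mderiv_real_tgauss /mderiv_real pderivs0. Qed.

Lemma normc_real (r : R) : normc (real_complex R r) = `|r|.
Proof. by rewrite /= expr0n /= addr0 sqrtr_sqr. Qed.

Lemma normc_ge0 z : 0 <= normc z.
Proof. by case: z => u v; exact: sqrtr_ge0. Qed.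

(** Every estimate below reads the norm through this pointwise form. *)
Lemma wnorm_leP M l h f (r : R) : weight_matrix M -> 0 < l -> 0 < h ->
  (wnorm M l h f <= r%:E)%E <->
  (forall a b x, normc (real_complex R (monomial a x) * mderiv b f x) <=
     r * (h ^+ mlength (a + b) * M l (a + b))).
Proof.
move=> [M0 _ _] l0 h0.
have w0 a : 0 < h ^+ mlength a * M l a by rewrite mulr_gt0 ?exprn_gt0 ?M0.
split=> [H a b x|H].
  rewrite -ler_pdivrMr// -lee_fin EFinM.
  apply: le_trans H; apply: le_trans (ereal_sup_ubound _); last by exists (a, b).
  rewrite /= lee_pmul2r ?lte_fin ?invr_gt0 ?w0//.
  by apply: ereal_sup_ubound; exists x.
apply: ge_ereal_sup => _ [[a b] _ <-] /=.
rewrite -lee_pdivlMr ?invr_gt0 ?w0// -EFinM invrK.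
by apply: ge_ereal_sup => _ [x _ <-]; rewrite lee_fin.
Qed.

End derivatives.

(** * Subgradients of convex functions on the orthant *)

Section subgradient.
Variables (R : realType) (d : nat).
Implicit Types (x y z al : 'rV[R]_d).
Local Notation orthant := [set x : 'rV[R]_d | forall j, 0 <= x 0 j].

Lemma convex_orthant (F : 'rV[R]_d -> R) x y (p q : R) :
  convex_function orthant F -> orthant x -> orthant y -> 0 < p -> 0 < q ->
  (p + q) * F ((p / (p + q)) *: x + (q / (p + q)) *: y) <= p * F x + q * F y.
Proof.
move=> cF Dx Dy p0 q0; have pq : 0 < p + q by exact: addr_gt0.
have r0 : 0 <= p / (p + q) by rewrite divr_ge0// ltW.
have r1 : p / (p + q) <= 1 by rewrite ler_pdivrMr// mul1r lerDl ltW.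
have := cF (Itv01 r0 r1) x y (mem_set Dx) (mem_set Dy).
rewrite [X in F X](_ : _ = (p / (p + q)) *: x + (1 - p / (p + q)) *: y)//.
rewrite [X in _ <= X](_ : _ = (p / (p + q)) * F x + (1 - p / (p + q)) * F y)//.
have -> : 1 - p / (p + q) = q / (p + q) by field; rewrite gt_eqF.
move=> h; rewrite -ler_pdivlMl//; apply: le_trans h _; rewrite le_eqVlt; apply/orP; left.
by apply/eqP; field; rewrite gt_eqF.
Qed.

(** One step of the Hahn-Banach argument: if phi is convex on S and
nonnegative on the slice x_j = al_j, then the slopes of phi from the points of S
below the slice are at most the slopes to the points above it, and any c
between them works.  Convexity enters only through pairs of points on either
side of the slice. *)
Lemma subgradient_step (phi : 'rV[R]_d -> R) (S : set 'rV[R]_d) al (j : 'I_d) :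
  (forall x y p q, S x -> S y -> 0 < p -> 0 < q ->
     p * (x 0 j - al 0 j) + q * (y 0 j - al 0 j) = 0 -> 0 <= p * phi x + q * phi y) ->
  (forall x, S x -> x 0 j = al 0 j -> 0 <= phi x) ->
  (exists2 x, S x & al 0 j < x 0 j) -> (exists2 y, S y & y 0 j < al 0 j) ->
  exists c, forall x, S x -> c * (x 0 j - al 0 j) <= phi x.
Proof.
move=> conv phi0 [x0 Sx0 x0al] [y0 Sy0 y0al].
pose A := [set phi y / (y 0 j - al 0 j) | y in [set y | S y /\ y 0 j < al 0 j]].
have ubA x : S x -> al 0 j < x 0 j -> ubound A (phi x / (x 0 j - al 0 j)).
  move=> Sx alx _ [y [Sy yal] <-].
  have xp : 0 < x 0 j - al 0 j by rewrite subr_gt0.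
  have yp : 0 < al 0 j - y 0 j by rewrite subr_gt0.
  have := conv x y _ _ Sx Sy yp xp.
  have -> : (al 0 j - y 0 j) * (x 0 j - al 0 j) + (x 0 j - al 0 j) * (y 0 j - al 0 j) = 0.
    by ring.
  move=> /(_ erefl) h.
  rewrite -[y 0 j - _]opprB invrN mulrN -mulNr ler_pdivlMr// mulrAC ler_pdivrMr//.
  lra.
(* the least admissible slope *)
exists (sup A) => x Sx; have [xal|alx|E] := ltgtP (x 0 j) (al 0 j).
- have yp : 0 < al 0 j - x 0 j by rewrite subr_gt0.
  rewrite -opprB mulrN lerNl -ler_pdivrMr//.
  apply: ub_le_sup; first by exists (phi x0 / (x0 0 j - al 0 j)); exact: ubA.
  by exists x => //; rewrite -[x 0 j - _]opprB invrN mulrN mulNr.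
- rewrite -ler_pdivlMr ?subr_gt0//; apply: ge_sup; last exact: ubA.
  by exists (phi y0 / (y0 0 j - al 0 j)), y0.
- by rewrite E subrr mulr0 phi0.
Qed.

(** At a boundary point of the orthant a convex function may have no
subgradient, the slopes being infinite; hence the restriction to the face of
al, in whose relative interior al lies.  The coordinates are treated one after
another: the functional is extended from the points agreeing with al in the
coordinates j >= k to those agreeing with al in the coordinates j > k. *)
Lemma convex_subgradient (F : 'rV[R]_d -> R) al :
  convex_function orthant F -> orthant al ->
  exists s : 'I_d -> R, forall x, orthant x ->
    (forall j, al 0 j = 0 -> x 0 j = 0) ->
    F al + \sum_j s j * (x 0 j - al 0 j) <= F x.
Proof.
move=> cF Dal.
suff H k : (k <= d)%N -> exists s : 'I_d -> R, forall x, orthant x ->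
    (forall j, al 0 j = 0 -> x 0 j = 0) ->
    (forall j : 'I_d, (k <= j)%N -> x 0 j = al 0 j) ->
    F al + \sum_j s j * (x 0 j - al 0 j) <= F x.
  have [s hs] := H d (leqnn _); exists s => x Dx x0; apply: hs => // j.
  by rewrite leqNgt ltn_ord.
elim: k => [_|k IHk kd].
  exists (fun=> 0) => x _ _ xal; rewrite big1 => [|j _]; last by rewrite mul0r.
  by rewrite addr0 (_ : x = al)//; apply/rowP => j; rewrite xal.
have [s hs] := IHk (ltnW kd); pose j := Ordinal kd.
have [al0|al0] := eqVneq (al 0 j) 0.
  exists s => x Dx x0 xal; apply: hs => // i; rewrite leq_eqVlt => /orP[/eqP ki|/xal//].
  have -> : i = j by exact/val_inj.
  by rewrite x0.
have alj : 0 < al 0 j by rewrite lt_neqAle eq_sym al0 Dal.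
(* j is excluded from the sum: its slope is what has to be found *)
pose phi x := F x - F al - \sum_(i | i != j) s i * (x 0 i - al 0 i).
pose S := [set x | [/\ orthant x, forall j, al 0 j = 0 -> x 0 j = 0 &
   forall j : 'I_d, (k.+1 <= j)%N -> x 0 j = al 0 j]].
have phi0 x : S x -> x 0 j = al 0 j -> 0 <= phi x.
  move=> [Dx x0 xal] xj; have := hs x Dx x0.
  rewrite (bigD1 j)//= xj subrr mulr0 add0r => h.
  rewrite /phi -addrA -opprD subr_ge0; apply: h => i.
  rewrite leq_eqVlt => /orP[/eqP ki|/xal//].
  by have -> : i = j by exact/val_inj.
have [c hc] : exists c, forall x, S x -> c * (x 0 j - al 0 j) <= phi x.
  apply: subgradient_step => //.
  - move=> x y p q Sx Sy p0 q0 pq; have pq0 : 0 < p + q by exact: addr_gt0.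
    pose z := (p / (p + q)) *: x + (q / (p + q)) *: y.
    have zE i : (p + q) * (z 0 i - al 0 i) = p * (x 0 i - al 0 i) + q * (y 0 i - al 0 i).
      by rewrite !mxE; field; rewrite gt_eqF.
    have zal i : x 0 i = al 0 i -> y 0 i = al 0 i -> z 0 i = al 0 i.
      move=> xi yi; apply/eqP; rewrite -subr_eq0 -(mulrI_eq0 _ (mulfI (lt0r_neq0 pq0))).
      by rewrite zE xi yi !subrr !mulr0 addr0.
    have [Dx x0 xal] := Sx; have [Dy y0 yal] := Sy.
    have Sz : S z.
      split=> [i|i al_i|i ki].
      - by rewrite !mxE addr_ge0// mulr_ge0 ?divr_ge0// ltW.
      - by rewrite -al_i; apply: zal; rewrite al_i ?x0 ?y0.
      - by apply: zal; [exact: xal|exact: yal].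
    have zj : z 0 j = al 0 j.
      apply/eqP; rewrite -subr_eq0 -(mulrI_eq0 _ (mulfI (lt0r_neq0 pq0))).
      by rewrite zE pq.
    have := mulr_ge0 (ltW pq0) (phi0 z Sz zj).
    have := convex_orthant cF Dx Dy p0 q0; rewrite -/z.
    have sE : (p + q) * (\sum_(i | i != j) s i * (z 0 i - al 0 i)) =
       p * (\sum_(i | i != j) s i * (x 0 i - al 0 i)) +
       q * (\sum_(i | i != j) s i * (y 0 i - al 0 i)).
      rewrite !mulr_sumr -big_split/=; apply: eq_bigr => i _.
      by rewrite mulrCA zE; ring.
    rewrite /phi mulrBr sE; lra.
  (* points of S above and below the slice *)
  - exists (al + delta_mx 0 j); last by rewrite !mxE !eqxx ltrDl.
    split=> [i|i al_i|i ki]; rewrite !mxE.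
    + by rewrite addr_ge0 ?Dal.
    + have -> : (i == j) = false by apply: contraTF alj => /eqP <-; rewrite al_i ltxx.
      by rewrite andbF addr0.
    + have -> : (i == j) = false by apply/eqP => ij; rewrite ij /= ltnn in ki.
      by rewrite andbF addr0.
  - exists (\row_i (if i == j then 0 else al 0 i)); last by rewrite !mxE eqxx.
    split=> [i|i al_i|i ki]; rewrite !mxE; case: eqP => [ij|_] //.
    by rewrite ij /= ltnn in ki.
exists (fun i => if i == j then c else s i) => x Dx x0 xal.
rewrite (bigD1 j)//= eqxx addrA.
under eq_bigr => i ij do rewrite (negPf ij).
have := hc x; rewrite /phi => /(_ (And3 Dx x0 xal)); lra.
Qed.

End subgradient.

(** * Norms of translated Gaussians *)

Section key_estimate.
Variables (R : realType) (d : nat).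
Implicit Types (t x : 'rV[R]_d) (a b n : 'rV[nat]_d) (M N : R -> 'rV[nat]_d -> R).
Local Notation normc := (@ComplexField.Normc.normc R).

Lemma monomial_ge0 a t : (forall j, 0 <= t 0 j) -> 0 <= monomial a t.
Proof. by move=> t0; apply: prodr_ge0 => j _; rewrite exprn_ge0. Qed.

Lemma monomialZ (c : R) a t : monomial a (c *: t) = c ^+ mlength a * monomial a t.
Proof.
rewrite /monomial expr_mlength -big_split; apply: eq_bigr => j _.
by rewrite mxE exprMn.
Qed.

(** The point t is the exponential of a subgradient s of log M at a: the
inequality is the exponential of log M_b >= log M_a + s (b - a).  Where a_j = 0
the point t has coordinate 0 (the slope - infinity), which kills the b outside
the face of a. *)
Lemma log_convex_touch M l a : weight_matrix M -> log_convex M -> 0 < l ->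
  exists t, [/\ forall j, 0 <= t 0 j, 0 < monomial a t &
    forall b, monomial b t * M l a <= monomial a t * M l b].
Proof.
move=> [M0 _ _] cM l0; have [F [cF FM]] := cM l l0.
pose al : 'rV[R]_d := \row_j (a 0 j)%:R.
have Dal j : 0 <= al 0 j by rewrite mxE.
have [s hs] := convex_subgradient cF Dal.
pose t : 'rV[R]_d := \row_j (if a 0 j == 0%N then 0 else expR (s j)).
have mt b : (forall j, a 0 j = 0%N -> b 0 j = 0%N) ->
    monomial b t = expR (\sum_j s j * (b 0 j)%:R).
  move=> ab; rewrite expR_sum; apply: eq_bigr => j _; rewrite mxE expRM_natr.
  by case: eqP => // /ab ->; rewrite !expr0.
exists t; split=> [j||b].
- by rewrite mxE; case: ifP => // _; exact: expR_ge0.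
- by rewrite mt// expR_gt0.
have [ab|] := pselect (forall j, a 0 j = 0%N -> b 0 j = 0%N); last first.
  move=> /existsNP[j /not_implyP[aj bj]].
  rewrite {1}/monomial (bigD1 j)//= mxE aj eqxx expr0n.
  move/eqP/negPf: bj => ->; rewrite !mul0r.
  by rewrite mulr_ge0 ?ltW ?M0// mt// expR_gt0.
rewrite !mt// -{1}(lnK (M0 _ a l0)) -{1}(lnK (M0 _ b l0)) -!expRD ler_expR -!FM.
have Db : [set x : 'rV[R]_d | forall j, 0 <= x 0 j] (\row_j (b 0 j)%:R).
  by move=> j; rewrite mxE.
have := hs _ Db; have -> : (\sum_j s j * ((\row_j (b 0 j)%:R : 'rV[R]_d) 0 j - al 0 j)) =
   \sum_j s j * (b 0 j)%:R - \sum_j s j * (a 0 j)%:R.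
  by rewrite -sumrB; apply: eq_bigr => j _; rewrite !mxE mulrBr.
have alb j : al 0 j = 0 -> (\row_j (b 0 j)%:R : 'rV[R]_d) 0 j = 0.
  by rewrite !mxE => /eqP; rewrite pnatr_eq0 => /eqP/ab ->.
move=> /(_ alb); rewrite -/al; lra.
Qed.

(** The upper bound on the test functions.  In the applications C is the
constant of (R1), or an arbitrarily small number in the case of (B1); the
point t is scaled accordingly, so that h = 2 C H is as small as desired in the
Beurling case. *)
Lemma wnorm_cgauss_le M l k (B C H K c : R) t : weight_matrix M ->
  0 < l -> 0 < k -> 0 <= B -> 0 < C -> 0 < H -> 0 <= c ->
  (forall j, 0 <= t 0 j) ->
  (forall a b, mhalfpow R a * M l b <=
      B * C ^+ mlength a * H ^+ mlength (a + b) * M k (a + b)) ->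
  (forall b, c * monomial b t <= K * C ^+ mlength b * M l b) ->
  (wnorm M k (2 * C * H) (cgauss c t) <= (K * B)%:E)%E.
Proof.
move=> wM l0 k0 B0 C0 H0 c0 t0 cond ct; have [M0 M1 _] := wM.
have K0 : 0 <= K.
  have := le_trans (mulr_ge0 c0 (monomial_ge0 0 t0)) (ct 0).
  by rewrite M1// mulr1 pmulr_lge0// exprn_gt0.
apply/wnorm_leP => //; first by rewrite !mulr_gt0.
move=> a b x; rewrite mderiv_cgauss -rmorphM normc_real mulrCA normrM (ger0_norm c0).
have [a1 [a2 [aE h]]] := tgauss_le a b x t0.
apply: le_trans (ler_wpM2l c0 h) _.
have mh0 e : 0 <= mhalfpow R e by apply: prodr_ge0 => j _; rewrite powR_ge0.
have -> : c * (2 ^+ mlength (a + b) * mhalfpow R (a2 + b) * monomial a1 t) =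
   2 ^+ mlength (a + b) * mhalfpow R (a2 + b) * (c * monomial a1 t) by ring.
apply: (le_trans (ler_wpM2l _ (ct a1))); first by rewrite mulr_ge0 ?exprn_ge0.
have -> : 2 ^+ mlength (a + b) * mhalfpow R (a2 + b) * (K * C ^+ mlength a1 * M l a1) =
  2 ^+ mlength (a + b) * K * C ^+ mlength a1 * (mhalfpow R (a2 + b) * M l a1) by ring.
apply: (le_trans (ler_wpM2l _ (cond _ _))); first by rewrite !mulr_ge0 ?exprn_ge0// ltW.
have abE : a2 + b + a1 = a + b by rewrite aE addrC addrA.
rewrite abE !exprMn le_eqVlt; apply/orP; left; apply/eqP.
have -> : C ^+ mlength (a + b) = C ^+ mlength (a2 + b) * C ^+ mlength a1.
  by rewrite -abE mlengthD exprD.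
ring.
Qed.

Lemma tgauss_center t : tgauss t 0 t = 1.
Proof.
rewrite /tgauss big1// => j _; rewrite mxE /gauss_der subrr /gauss hornerC.
by rewrite expr0n mul0r oppr0 expR0 mulr1.
Qed.

(** The contribution to the norm of the indices (a, 0), read at one point. *)
Definition monomial_at a t (f : 'rV[R]_d -> R[i]) : R := normc (f t) * `|monomial a t|.

Lemma wnorm_lower N k h f r a t : weight_matrix N -> 0 < k -> 0 < h ->
  (wnorm N k h f <= r%:E)%E -> monomial_at a t f <= r * (h ^+ mlength a * N k a).
Proof.
move=> wN k0 h0 /(wnorm_leP _ _ wN k0 h0)/(_ a 0 t).
rewrite addr0 ComplexField.Normc.normcM normc_real /mderiv /mderiv_real.
have -> : flatten [seq nseq ((0%R : 'rV[nat]_d) 0%R j) j | j <- enum 'I_d] = [::].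
  by elim: (enum _) => //= j s ->; rewrite mxE.
by rewrite /= mulrC /monomial_at; case: (f t).
Qed.

Lemma monomial_at_cgauss a c t : 0 <= c -> (forall j, 0 <= t 0 j) ->
  monomial_at a t (cgauss c t) = c * monomial a t.
Proof.
move=> c0 t0; rewrite /monomial_at /cgauss tgauss_center mulr1 normc_real !ger0_norm//.
exact: monomial_ge0.
Qed.

End key_estimate.

(** * Polar neighborhoods and test functions *)

Section comparison.
Variables (R : realType) (d : nat).
Implicit Types (t x : 'rV[R]_d) (a b : 'rV[nat]_d) (M N : R -> 'rV[nat]_d -> R).
Implicit Types (f g : 'rV[R]_d -> R[i]).
Local Notation normc := (@ComplexField.Normc.normc R).

Lemma wnorm_dom M N l k h h' K r f : weight_matrix M -> weight_matrix N ->
  0 < l -> 0 < k -> 0 < h -> 0 < h' -> 0 <= r ->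
  (forall a, h ^+ mlength a * M l a <= K * (h' ^+ mlength a * N k a)) ->
  (wnorm M l h f <= r%:E)%E -> (wnorm N k h' f <= (K * r)%:E)%E.
Proof.
move=> wM wN l0 k0 h0 h'0 r0 MN /(wnorm_leP _ _ wM l0 h0) H.
apply/wnorm_leP => // a b x; apply: le_trans (H a b x) _.
by rewrite [K * r]mulrC -mulrA ler_wpM2l.
Qed.

Lemma wnorm_fin M l h f : (wnorm M l h f < +oo)%E ->
  exists2 r : R, 0 <= r & (wnorm M l h f <= r%:E)%E.
Proof.
case E : (wnorm M l h f) => [r||] // _; last by exists 0 => //; rewrite leNye.
by exists `|r|; rewrite ?normr_ge0// lee_fin ler_norm.
Qed.

Lemma mlength_eq0 a : mlength a = 0%N -> a = 0.
Proof.
move=> /eqP; rewrite /mlength sum_nat_eq0 => /forallP h.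
by apply/rowP => j; rewrite mxE; apply/eqP; have := h j.
Qed.

Lemma monomial_at_comb a t f g (p q : R[i]) :
  monomial_at a t (fun x => p * f x + q * g x) <=
  normc p * monomial_at a t f + normc q * monomial_at a t g.
Proof.
rewrite /monomial_at !mulrA -mulrDl ler_wpM2r// -!ComplexField.Normc.normcM.
exact: le_normcD.
Qed.

Lemma absolutely_convex_wball M l h r : weight_matrix M -> 0 < l -> 0 < h -> 0 <= r ->
  absolutely_convex [set f | smooth f /\ (wnorm M l h f <= r%:E)%E].
Proof.
move=> wM l0 h0 r0 f g p q [sf nf] [sg ng] pq.
have [E s] := smooth_comb p q sf sg; split=> //.
apply/wnorm_leP => // a b x; rewrite E.
have w0 : 0 <= r * (h ^+ mlength (a + b) * M l (a + b)).
  by have [M0 _ _] := wM; rewrite !mulr_ge0 ?exprn_ge0// ltW// M0.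
have {}nf := (wnorm_leP f r wM l0 h0).1 nf a b x.
have {}ng := (wnorm_leP g r wM l0 h0).1 ng a b x.
rewrite mulrDr ![real_complex R _ * (_ * _)]mulrCA.
apply: le_trans (le_normcD _ _) _; rewrite (ComplexField.Normc.normcM p) (ComplexField.Normc.normcM q).
apply: le_trans (lerD (ler_wpM2l (normc_ge0 p) nf) (ler_wpM2l (normc_ge0 q) ng)) _.
by rewrite -mulrDl ler_piMl.
Qed.

Lemma open_roumieuE M (U : set (roumieu_space M)) : open U = roumieu_open U.
Proof. by []. Qed.

Lemma open_beurlingE M (U : set (beurling_space M)) : open U = beurling_open U.
Proof. by []. Qed.

Section polar.
Variables (I : Type) (A : I -> 'rV[nat]_d) (T : I -> 'rV[R]_d) (W : I -> R).

(** The neighborhoods of 0 used as tests: they bound f itself at prescribed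
points, which will be the centers of the Gaussians. *)
Definition polar (s : R) : set ('rV[R]_d -> R[i]) :=
  [set f | forall i, monomial_at (A i) (T i) f <= s * W i].

Lemma absolutely_convex_polar s : (forall i, 0 <= W i) -> 0 <= s ->
  absolutely_convex (polar s).
Proof.
move=> W0 s0 f g p q Vf Vg pq i; apply: le_trans (monomial_at_comb _ _ _ _ _ _) _.
apply: le_trans (lerD (ler_wpM2l (normc_ge0 p) (Vf i)) (ler_wpM2l (normc_ge0 q) (Vg i))) _.
by rewrite -mulrDl ler_piMl// mulr_ge0.
Qed.

Lemma polar_sub r s f g : polar r f -> polar s (fun x => g x - f x) -> polar (r + s) g.
Proof.
move=> Vf Vg i; rewrite mulrDl; apply: le_trans (lerD (Vf i) (Vg i)).
have := monomial_at_comb (A i) (T i) f (fun x => g x - f x) 1 1.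
rewrite ComplexField.Normc.normc1 !mul1r; apply: le_trans.
by rewrite /monomial_at mul1r /= [1 * (_ - _)]mul1r [f _ + _]addrC subrK.
Qed.

(** Open version of the polar with s = 1: the condition must hold with some
room to spare, uniformly in the index. *)
Definition open_polar : set ('rV[R]_d -> R[i]) := [set f | exists2 r, r < 1 & polar r f].

Lemma open_polar_roumieu N : (forall s, 0 < s -> indlim_nbhs0 N (polar s)) ->
  open [set f : roumieu_space N | open_polar f].
Proof.
move=> nV; rewrite open_roumieuE => f [r r1 Vf]; exists (polar ((1 - r) / 2)).
  by apply: nV; rewrite divr_gt0// subr_gt0.
move=> g Vg; exists (r + (1 - r) / 2); last exact: polar_sub Vf Vg.
lra.
Qed.

Lemma open_polar_beurling N l h : weight_matrix N -> 0 < l -> 0 < h ->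
  (forall i, W i = h ^+ mlength (A i) * N l (A i)) ->
  open [set f : beurling_space N | open_polar f].
Proof.
move=> wN l0 h0 WE; rewrite open_beurlingE => f [r r1 Vf]; exists [:: (l, h)], ((1 - r) / 2).
  by rewrite divr_gt0// subr_gt0.
split=> [p|g H]; first by rewrite inE => /eqP ->.
exists (r + (1 - r) / 2); first lra.
apply: polar_sub Vf _ => i; rewrite WE; apply: (wnorm_lower _ _ wN) => //.
by apply: ltW; apply: (H (l, h)); rewrite inE.
Qed.

End polar.

(** The height c and the center t for which c t^b, compared with the weights
C^|b| M_b, touches them from below at b = a. *)
Lemma log_convex_gauss M l (C : R) a : weight_matrix M -> log_convex M -> 0 < l -> 0 < C ->
  exists t c, [/\ 0 <= c, forall j, 0 <= t 0 j,
    c * monomial a t = C ^+ mlength a * M l a &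
    forall b, c * monomial b t <= C ^+ mlength b * M l b].
Proof.
move=> wM cM l0 C0; have [t [t0 mt ht]] := log_convex_touch a wM cM l0.
have [M0 _ _] := wM.
exists (C *: t), (M l a / monomial a t); split=> [|j||b].
- by rewrite divr_ge0// ltW// M0.
- by rewrite mxE mulr_ge0// ltW.
- by rewrite monomialZ; field; rewrite gt_eqF.
- rewrite monomialZ mulrCA ler_wpM2l ?exprn_ge0 ?(ltW C0)//.
  by rewrite mulrAC ler_pdivrMr// mulrC [leRHS]mulrC.
Qed.

Lemma cgauss0 : cgauss 0 (0 : 'rV[R]_d) = (fun _ => 0).
Proof. by apply/funext => x; rewrite /cgauss mul0r. Qed.

Lemma smooth0 : smooth (fun _ : 'rV[R]_d => 0 : R[i]).
Proof. by rewrite -cgauss0; exact: smooth_cgauss. Qed.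

Lemma wnorm0 M l h : weight_matrix M -> 0 < l -> 0 < h ->
  (wnorm M l h (fun _ : 'rV[R]_d => 0%R : R[i]) <= 0)%E.
Proof.
move=> wM l0 h0; apply/wnorm_leP => // a b x.
by rewrite mul0r -cgauss0 mderiv_cgauss !mul0r mulr0 ComplexField.Normc.normc0.
Qed.

Lemma roumieu0 M : weight_matrix M -> roumieu M (fun _ : 'rV[R]_d => 0 : R[i]).
Proof.
move=> wM; split; first exact: smooth0.
by exists 1, 1; split=> //; apply: le_lt_trans (wnorm0 wM _ _) _.
Qed.

Lemma beurling0 M : weight_matrix M -> beurling M (fun _ : 'rV[R]_d => 0 : R[i]).
Proof.
move=> wM; split; first exact: smooth0.
by move=> l h l0 h0; apply: le_lt_trans (wnorm0 wM l0 h0) _.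
Qed.

(** The normalization M_0 = N_0 = 1 gives the case a = 0; for a <> 0 the
constant K is at most max(1,K)^|a|. *)
Lemma absorb_constant M N k l (K D : R) : weight_matrix M -> weight_matrix N ->
  0 < k -> 0 < l -> 0 < D -> (forall a, M k a <= K * D ^+ mlength a * N l a) ->
  exists2 C, 1 <= C & forall a, M k a <= C ^+ mlength a * N l a.
Proof.
move=> [M0 M1 _] [N0 N1 _] k0 l0 D0 h.
pose K' := Num.max 1 K; have K'1 : 1 <= K' by rewrite le_max lexx.
pose C := Num.max 1 (K' * D); exists C; first by rewrite le_max lexx.
move=> a; have [a0|a0] := posnP (mlength a).
  by rewrite a0 (mlength_eq0 a0) M1// N1// mulr1.
apply: le_trans (h a) _; apply: ler_wpM2r; first by rewrite ltW// N0.
apply: (@le_trans _ _ ((K' * D) ^+ mlength a)).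
  rewrite exprMn; apply: ler_wpM2r; first by rewrite exprn_ge0// ltW.
  apply: (@le_trans _ _ K').
    by rewrite le_max lexx orbT.
  by rewrite -[leLHS]expr1 ler_weXn2l.
have KD : 0 <= K' * D by rewrite mulr_ge0 ?ltW// (lt_le_trans ltr01).
by rewrite lerXn2r ?nnegrE// ?le_max ?lexx ?orbT// KD orbT.
Qed.

End comparison.

(** * Domination of weights gives continuous inclusions *)

Section sufficiency.
Variables (R : realType) (d : nat).
Implicit Types (M N : R -> 'rV[nat]_d -> R).

Lemma prec_roumieu_continuous M N : weight_matrix M -> weight_matrix N ->
  prec_roumieu M N ->
  exists sMN : roumieu M `<=` roumieu N,
    continuous (fun f : roumieu_space M => RoumieuSpace (sMN f (roumieuP f))).
Proof.
move=> wM wN MN.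
have dom l h : 0 < l -> 0 < h -> exists k h', [/\ 0 < k, 0 < h' & forall f r,
    0 <= r -> (wnorm M l h f <= r%:E)%E -> (wnorm N k h' f <= r%:E)%E].
  move=> l0 h0; have [k [C [k0 C1 H]]] := MN l l0.
  have C0 : 0 < C by exact: lt_le_trans C1.
  exists k, (h * C); split=> [//||f r r0]; first exact: mulr_gt0.
  rewrite -[X in _ -> (_ <= X%:E)%E]mul1r; apply: wnorm_dom => //.
    exact: mulr_gt0.
  by move=> a; rewrite mul1r exprMn -mulrA ler_wpM2l ?exprn_ge0// ltW.
have sMN : roumieu M `<=` roumieu N.
  move=> f [sf [l [h [l0 h0 /wnorm_fin[r r0 nf]]]]]; split=> //.
  have [k [h' [k0 h'0 H]]] := dom l h l0 h0.
  by exists k, h'; split=> //; apply: le_lt_trans (H f r r0 nf) (ltry _).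
exists sMN; apply/continuousP => U; rewrite !open_roumieuE => oU f Uf.
have [V [cV nV] VU] := oU _ Uf; exists V; last by move=> g Vg; exact: VU.
split=> // l h l0 h0; have [k [h' [k0 h'0 H]]] := dom l h l0 h0.
have [e e0 eV] := nV k h' k0 h'0.
have e2 : 0 < e / 2 by rewrite divr_gt0.
exists (e / 2) => // g [sg _] /ltW/(H _ _ (ltW e2)) ng; apply: eV.
  by split=> //; apply: le_lt_trans ng (ltry _).
by apply: le_lt_trans ng _; rewrite lte_fin; lra.
Qed.

(** A neighborhood of 0 in the Beurling space is given by finitely many
seminorms; its trace is a neighborhood in the inductive limit since each of
them is continuous on every step. *)
Lemma triangle_prec_continuous M N : weight_matrix M -> weight_matrix N ->
  triangle_prec M N ->
  exists sMN : roumieu M `<=` beurling N,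
    continuous (fun f : roumieu_space M => BeurlingSpace (sMN f (roumieuP f))).
Proof.
move=> wM wN MN.
have dom l h k h' : 0 < l -> 0 < h -> 0 < k -> 0 < h' -> exists2 C : R, 1 <= C &
    forall f r, 0 <= r -> (wnorm M l h f <= r%:E)%E -> (wnorm N k h' f <= (C * r)%:E)%E.
  move=> l0 h0 k0 h'0.
  have [C C1 H] := MN l k (h' / h) l0 k0 (divr_gt0 h'0 h0).
  exists C => // f r r0; apply: wnorm_dom => // a.
  have := ler_wpM2l (exprn_ge0 (mlength a) (ltW h0)) (H a); congr (_ <= _).
  by rewrite expr_div_n; field; rewrite expf_neq0// gt_eqF.
have sMN : roumieu M `<=` beurling N.
  move=> f [sf [l [h [l0 h0 /wnorm_fin[r r0 nf]]]]]; split=> // k h' k0 h'0.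
  have [C _ H] := dom l h k h' l0 h0 k0 h'0.
  by apply: le_lt_trans (H f r r0 nf) (ltry _).
exists sMN; apply/continuousP => U.
rewrite open_roumieuE open_beurlingE => oU f Uf.
have [s [e e0 [s0 sU]]] := oU _ Uf.
have e2 : 0 < e / 2 by rewrite divr_gt0.
exists [set g | smooth g /\ forall p, p \in s -> (wnorm N p.1 p.2 g <= (e / 2)%:E)%E];
  last first.
  move=> g [_ Vg]; apply: sU => p ps; apply: le_lt_trans (Vg p ps) _.
  by rewrite lte_fin; lra.
split=> [u v p q [su Vu] [sv Vv] pq|l h l0 h0].
  split=> [|w ws]; first by have [_] := smooth_comb p q su sv.
  have [w1 w2] := s0 w ws.
  exact: (absolutely_convex_wball wN w1 w2 (ltW e2) (conj su (Vu w ws)) (conj sv (Vv w ws)) pq).2.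
suff [e' e'0 H] : exists2 e' : R, 0 < e' & forall g p, p \in s ->
    (wnorm M l h g <= e'%:E)%E -> (wnorm N p.1 p.2 g <= (e / 2)%:E)%E.
  by exists e' => // g [sg _] /ltW ng; split=> // p ps; exact: (H g p ps ng).
elim: s s0 {sU} => [|p s IHs] s0; first by exists 1.
have [q qs|e1 e10 H1] := IHs; first by apply: s0; rewrite inE qs orbT.
have [p1 p2] := s0 p (mem_head _ _).
have [C C1 H] := dom l h p.1 p.2 l0 h0 p1 p2.
have C0 : 0 < C by exact: lt_le_trans C1.
have eC : 0 < e / 2 / C by rewrite divr_gt0.
exists (Num.min e1 (e / 2 / C)) => [|g q]; first by rewrite lt_min e10.
rewrite inE => /orP[/eqP -> ng|qs ng].
  have -> : e / 2 = C * (e / 2 / C) by rewrite [RHS]mulrC divfK// gt_eqF.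
  by apply: H; [exact: ltW|apply: le_trans ng _; rewrite lee_fin ge_min lexx orbT].
by apply: H1 => //; apply: le_trans ng _; rewrite lee_fin ge_min lexx.
Qed.

Lemma prec_beurling_continuous M N : weight_matrix M -> weight_matrix N ->
  prec_beurling M N ->
  exists sMN : beurling M `<=` beurling N,
    continuous (fun f : beurling_space M => BeurlingSpace (sMN f (beurlingP f))).
Proof.
move=> wM wN MN.
have dom (p : R * R) : exists q : R * R, 0 < p.1 -> 0 < p.2 -> [/\ 0 < q.1, 0 < q.2 & forall f r,
    0 <= r -> (wnorm M q.1 q.2 f <= r%:E)%E -> (wnorm N p.1 p.2 f <= r%:E)%E].
  have [[l0 h0]|np] := pselect (0 < p.1 /\ 0 < p.2); last by exists p => l0 h0; case: np.
  have [k [C [k0 C1 H]]] := MN p.1 l0.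
  have C0 : 0 < C by exact: lt_le_trans C1.
  have hC : 0 < p.2 / C by exact: divr_gt0.
  exists (k, p.2 / C) => _ _; split=> // f r r0 /=.
  rewrite -[X in _ -> (_ <= X%:E)%E]mul1r; apply: wnorm_dom => // a.
  rewrite mul1r; have := ler_wpM2l (exprn_ge0 (mlength a) (ltW hC)) (H a).
  congr (_ <= _); rewrite expr_div_n; field; rewrite expf_neq0// gt_eqF//.
(* [dom] is total in p, with a junk value outside the positive parameters, so
   that the parameters for M become a function of those for N *)
have [q dq] := choice dom.
have sMN : beurling M `<=` beurling N.
  move=> f [sf nf]; split=> // l h l0 h0; have [q1 q2 H] := dq (l, h) l0 h0.
  have [r r0 nr] := wnorm_fin (nf _ _ q1 q2).
  by apply: le_lt_trans (H f r r0 nr) (ltry _).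
exists sMN; apply/continuousP => U; rewrite !open_beurlingE => oU f Uf.
have [s [e e0 [s0 sU]]] := oU _ Uf.
have e2 : 0 < e / 2 by rewrite divr_gt0.
exists (map q s), (e / 2) => //; split=> [_ /mapP[p /s0[p1 p2] ->]|g H].
  by have [] := dq p p1 p2.
apply: sU => p ps; have [p1 p2] := s0 p ps; have [q1 q2 dp] := dq p p1 p2.
apply: (@le_lt_trans _ _ (e / 2)%:E); last by rewrite lte_fin; lra.
by apply: dp; [exact: ltW|apply: ltW; apply: H; exact: map_f].
Qed.

End sufficiency.

(** * Continuous inclusions give domination of weights *)

Section necessity.
Variables (R : realType) (d : nat).
Implicit Types (M N : R -> 'rV[nat]_d -> R) (U : set ('rV[R]_d -> R[i])).
Implicit Types (t x : 'rV[R]_d) (a b : 'rV[nat]_d).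

(** The points T a depend on l but not on U: in the Roumieu case the open set
is built from them. *)
Lemma roumieu_test M l : weight_matrix M -> log_convex M -> R1 M -> 0 < l ->
  exists2 C : R, 0 < C & exists T : 'rV[nat]_d -> 'rV[R]_d,
    forall U, open [set f : roumieu_space M | U f] -> U (fun _ => 0) ->
    exists2 e : R, 0 < e & forall a, exists f,
      [/\ roumieu M f, U f & e * C ^+ mlength a * M l a <= monomial_at a (T a) f].
Proof.
move=> wM cM r1 l0; have [k [B [C [H [lk B0 C0 H0 cond]]]]] := r1 l l0.
have k0 : 0 < k by exact: lt_le_trans lk.
have h0 : 0 < 2 * C * H by rewrite !mulr_gt0.
exists C => //; have [T hT] := choice (fun a => log_convex_gauss a wM cM l0 C0).
exists T => U; rewrite open_roumieuE => oU U0.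
have [V [_ nV] VU] := oU (RoumieuSpace (roumieu0 wM)) U0.
have [e e0 eV] := nV k (2 * C * H) k0 h0.
pose r := e / (2 * B).
have r0 : 0 < r by rewrite divr_gt0// mulr_gt0.
exists r => // a; have [c [c0 t0 cE ct]] := hT a.
have rc0 : 0 <= r * c by rewrite mulr_ge0// ltW.
have nf : (wnorm M k (2 * C * H) (cgauss (r * c) (T a)) <= (r * B)%:E)%E.
  apply: (wnorm_cgauss_le (l := l)) => //; first exact: ltW.
  by move=> b; have := ler_wpM2l (ltW r0) (ct b); rewrite !mulrA.
have rB : r * B < e.
  have -> : r * B = e / 2 by rewrite /r; field; rewrite gt_eqF.
  lra.
have rf : roumieu M (cgauss (r * c) (T a)).
  split; first exact: smooth_cgauss.
  by exists k, (2 * C * H); split=> //; apply: le_lt_trans nf (ltry _).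
exists (cgauss (r * c) (T a)); split=> //.
  apply: (VU (RoumieuSpace rf)); rewrite /=; under eq_fun do rewrite subr0.
  apply: eV; last by apply: le_lt_trans nf _; rewrite lte_fin.
  by split; [exact: smooth_cgauss|apply: le_lt_trans nf (ltry _)].
by rewrite monomial_at_cgauss// -!mulrA cE.
Qed.

(** By (B1) with b = 0 the weights grow faster than any D^|a| a^(a/2), hence
faster than t^a for a fixed t. *)
Lemma beurling_cgauss M c t : weight_matrix M -> B1 M -> 0 <= c ->
  (forall j, 0 <= t 0 j) -> beurling M (cgauss c t).
Proof.
move=> wM b1 c0 t0; split; first exact: smooth_cgauss.
move=> l h l0 h0; have [k [H [k0 kl H0 cond]]] := b1 l l0.
have [k' [H' [k'0 _ H'0 cond']]] := b1 k k0; have [M0 M1 _] := wM.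
pose C := h / (2 * H); have C0 : 0 < C by rewrite divr_gt0// mulr_gt0.
have [B B0 HB] := cond C C0.
have [B' B'0 HB'] := cond' (C / H') (divr_gt0 C0 H'0).
have hE : h = 2 * C * H by rewrite /C; field; rewrite gt_eqF.
pose G := \prod_j (gauss (t 0 j))^-1.
have tG b : monomial b t <= G * mhalfpow R b.
  rewrite -big_split; apply: ler_prod => j _; rewrite exprn_ge0//= halfpowE.
  have g0 : 0 < gauss (t 0 j) by exact: expR_gt0.
  rewrite ler_pdivlMl// mulrC; apply: le_trans (expr_gauss_le _ _).
  by rewrite ger0_norm.
have G0 : 0 <= G by apply: prodr_ge0 => j _; rewrite invr_ge0 gauss_ge0.
rewrite hE; apply: le_lt_trans (ltry (c * G * B' * B)).
apply: (wnorm_cgauss_le (l := k)) => //; first exact: ltW.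
move=> b; apply: le_trans (ler_wpM2l c0 (tG b)) _.
have := HB' b 0; rewrite addr0 M1// mulr1 => h1.
have h2 : mhalfpow R b <= B' * C ^+ mlength b * M k b.
  apply: le_trans h1 _; rewrite expr_div_n.
  by rewrite le_eqVlt; apply/orP; left; apply/eqP; field; rewrite expf_neq0// gt_eqF.
have := ler_wpM2l (mulr_ge0 c0 G0) h2; congr (_ <= _); ring.
Qed.

Lemma beurling_params (s : seq (R * R)) : (forall p, p \in s -> 0 < p.1 /\ 0 < p.2) ->
  exists l h : R, [/\ 0 < l, 0 < h & forall p, p \in s -> l <= p.1 /\ h <= p.2].
Proof.
elim: s => [|p s IHs] s0; first by exists 1, 1.
have [q qs|l [h [l0 h0 H]]] := IHs; first by apply: s0; rewrite inE qs orbT.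
have [p1 p2] := s0 p (mem_head _ _).
exists (Num.min l p.1), (Num.min h p.2); split; rewrite ?lt_min ?l0 ?h0//.
move=> q; rewrite inE => /orP[/eqP ->|/H[ql qh]]; rewrite !ge_min ?lexx ?orbT//.
by rewrite ql qh.
Qed.

(** A neighborhood of 0 fixes h beforehand, and the quantifier on C in (B1)
allows 2 C H = h. *)
Lemma beurling_test M : weight_matrix M -> log_convex M -> B1 M ->
  forall U, open [set f : beurling_space M | U f] -> U (fun _ => 0) ->
  exists k C e : R, [/\ 0 < k, 0 < C, 0 < e & forall a, exists t f,
      [/\ beurling M f, U f & e * C ^+ mlength a * M k a <= monomial_at a t f]].
Proof.
move=> wM cM b1 U; rewrite open_beurlingE => oU U0.
have [s [e e0 [s0 sU]]] := oU (BeurlingSpace (beurling0 wM)) U0.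
have [l [h [l0 h0 lh]]] := beurling_params s0.
have [k [H [k0 kl H0 cond]]] := b1 l l0; have [M0 M1 Mle] := wM.
pose C := h / (2 * H); have C0 : 0 < C by rewrite divr_gt0// mulr_gt0.
have hE : h = 2 * C * H by rewrite /C; field; rewrite gt_eqF.
have [B B0 HB] := cond C C0.
pose r := e / (2 * B).
have r0 : 0 < r by rewrite divr_gt0// mulr_gt0.
exists k, C, r; split=> // a.
have [t [c [c0 t0 cE ct]]] := log_convex_gauss a wM cM k0 C0.
have rc0 : 0 <= r * c by rewrite mulr_ge0// ltW.
have nf : (wnorm M l h (cgauss (r * c) t) <= (r * B)%:E)%E.
  rewrite hE; apply: (wnorm_cgauss_le (l := k)) => //; first exact: ltW.
  by move=> b; have := ler_wpM2l (ltW r0) (ct b); rewrite !mulrA.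
have rB : r * B < e.
  have -> : r * B = e / 2 by rewrite /r; field; rewrite gt_eqF.
  lra.
exists t, (cgauss (r * c) t); split.
- exact: beurling_cgauss.
- apply: (sU (BeurlingSpace (beurling_cgauss wM b1 rc0 t0))) => p ps /=.
  under eq_fun do rewrite subr0.
  have [lp hp] := lh p ps; have [p1 p2] := s0 p ps.
  apply: (@le_lt_trans _ _ (1 * (r * B))%:E); last by rewrite mul1r lte_fin.
  apply: wnorm_dom nf => //; first by rewrite mulr_ge0// ltW.
  move=> b; rewrite mul1r ler_pM ?exprn_ge0 ?(ltW h0) ?(ltW (M0 _ _ l0)) ?Mle//.
  by rewrite lerXn2r ?nnegrE ?(ltW h0) ?(ltW p2).
- by rewrite monomial_at_cgauss// -!mulrA cE.
Qed.

(** On the step with parameters l and h, the conditions with n >= max(l,h) hold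
on the whole ball of radius s, because the weights increase with the
parameter; the finitely many others only shrink the ball. *)
Lemma indlim_nbhs0_polar N (A : nat -> 'rV[nat]_d) (T : nat -> 'rV[R]_d) s :
  weight_matrix N -> 0 < s ->
  indlim_nbhs0 N (polar A T (fun n => n.+1%:R ^+ mlength (A n) * N n.+1%:R (A n)) s).
Proof.
move=> wN s0; have [N0 _ Nle] := wN; set W := fun n => _.
have W0 n : 0 < W n by rewrite mulr_gt0 ?exprn_gt0 ?N0.
split; first by apply: absolutely_convex_polar => [n|]; exact: ltW.
move=> l h l0 h0.
pose m := maxn (Num.truncn l).+1 (Num.truncn h).+1.
pose q n := h ^+ mlength (A n) * N l (A n) / W n.
have q0 n : 0 < q n by rewrite divr_gt0// mulr_gt0 ?exprn_gt0 ?N0.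
pose Q := 1 + \sum_(n < m) q n.
have Q0 : 0 < Q by rewrite ltr_pwDl// sumr_ge0// => n _; exact: ltW.
have qQ n : q n <= Q.
  have [nm|mn] := ltnP n m.
    rewrite /Q (bigD1 (Ordinal nm))//= addrCA lerDl addr_ge0// sumr_ge0// => i _.
    exact: ltW.
  apply: (@le_trans _ _ 1); last by rewrite lerDl sumr_ge0// => i _; exact: ltW.
  rewrite ler_pdivrMr// mul1r ler_pM ?exprn_ge0 ?(ltW h0) ?(ltW (N0 _ _ l0))//.
    rewrite lerXn2r ?nnegrE ?(ltW h0)// ltW// (lt_le_trans (truncnS_gt _))// ler_nat.
    by rewrite (leq_trans _ (leqW mn))// leq_maxr.
  apply: Nle => //; rewrite ltW// (lt_le_trans (truncnS_gt _))// ler_nat.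
  by rewrite (leq_trans _ (leqW mn))// leq_maxl.
exists (s / Q) => [|g [sg _] /ltW ng n]; first exact: divr_gt0.
apply: le_trans (wnorm_lower (A n) (T n) wN l0 h0 ng) _.
have := qQ n; rewrite ler_pdivrMr// => h1.
rewrite mulrAC ler_pdivrMr// -mulrA ler_wpM2l ?(ltW s0)//; by rewrite [leRHS]mulrC.
Qed.

(** By contradiction: the indices [A n] violate the domination with parameter
n + 1 and constant [X n], which is chosen so that C * X n >= (n + 1)^2.  The test
functions then show e (n + 1) < 1 for all n. *)
Lemma continuous_prec_roumieu M N (sMN : roumieu M `<=` roumieu N) :
  weight_matrix M -> weight_matrix N -> log_convex M -> R1 M ->
  continuous (fun f : roumieu_space M => RoumieuSpace (sMN f (roumieuP f))) ->
  prec_roumieu M N.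
Proof.
move=> wM wN cM r1 cont l l0; have [C C0 [T HT]] := roumieu_test wM cM r1 l0.
have [M0 M1 _] := wM; have [N0 N1 _] := wN.
apply: contrapT => nex.
pose X (n : nat) : R := n.+1%:R ^+ 2 * (1 + C^-1).
have X1 n : 1 <= X n.
  by rewrite -[leLHS]mulr1 ler_pM// ?exprn_ege1 ?ler1n// lerDl invr_ge0 ltW.
have viol n : exists a, X n ^+ mlength a * N n.+1%:R a < M l a.
  apply: contrapT => na; apply: nex; exists n.+1%:R, (X n); split=> // a.
  by rewrite leNgt; apply/negP => va; apply: na; exists a.
have [A HA] := choice viol.
pose W n := n.+1%:R ^+ mlength (A n) * N n.+1%:R (A n).
pose U := open_polar A (T \o A) W.
have oU : open [set f : roumieu_space N | U f].
  by apply: open_polar_roumieu => s s0; exact: indlim_nbhs0_polar.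
have oU' : open [set f : roumieu_space M | U f] by have := (continuousP _).1 cont _ oU.
have W0 n : 0 < W n by rewrite mulr_gt0 ?exprn_gt0 ?N0.
have [e e0 He] : exists2 e : R, 0 < e & forall a, exists f,
      [/\ roumieu M f, U f & e * C ^+ mlength a * M l a <= monomial_at a (T a) f].
  apply: HT => //; exists 0 => // n.
  by rewrite /monomial_at ComplexField.Normc.normc0 !mul0r.
have key n : e * n.+1%:R < 1.
  have [f [_ [r r1' Vf] lef]] := He (A n).
  have WN : e * C ^+ mlength (A n) * M l (A n) < W n.
    by apply: le_lt_trans lef (le_lt_trans (Vf n) _); rewrite gtr_pMl.
  have lenA : (0 < mlength (A n))%N.
    rewrite lt0n; apply/eqP => A0; have := HA n.
    by rewrite A0 (mlength_eq0 A0) M1// N1// mulr1 expr0 ltxx.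
  have CX : n.+1%:R ^+ 2 <= C * X n.
    rewrite /X mulrCA mulrDr mulr1 divff ?gt_eqF// ler_peMr ?exprn_ge0//.
    by rewrite lerDr ltW.
  have h1 : e * (n.+1%:R ^+ 2) ^+ mlength (A n) < n.+1%:R ^+ mlength (A n).
    rewrite -(ltr_pM2r (N0 n.+1%:R (A n) (ltr0Sn _ _))).
    apply: le_lt_trans WN; rewrite -!mulrA ler_wpM2l ?(ltW e0)//.
    apply: le_trans (ler_wpM2l (exprn_ge0 _ (ltW C0)) (ltW (HA n))).
    rewrite mulrA ler_wpM2r ?(ltW (N0 _ _ _))// -exprMn.
    have CX0 := mulr_ge0 (ltW C0) (le_trans ler01 (X1 n)).
    by rewrite lerXn2r ?nnegrE ?exprn_ge0.
  have n1 : 1 <= n.+1%:R :> R by rewrite ler1n.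
  have h2 : e * n.+1%:R ^+ mlength (A n) < 1.
    by move: h1; rewrite -exprM mulnC exprM expr2 mulrA gtr_pMl//.
  apply: le_lt_trans h2; rewrite ler_wpM2l ?(ltW e0)//.
  by rewrite -[leLHS]expr1 ler_weXn2l.
have := key (Num.truncn e^-1).
by rewrite ltNge -ler_pdivrMl// mulr1 ltW// truncnS_gt.
Qed.

Lemma continuous_triangle_prec M N (sMN : roumieu M `<=` beurling N) :
  weight_matrix M -> weight_matrix N -> log_convex M -> R1 M ->
  continuous (fun f : roumieu_space M => BeurlingSpace (sMN f (roumieuP f))) ->
  triangle_prec M N.
Proof.
move=> wM wN cM r1 cont l k h l0 k0 h0.
have [C C0 [T HT]] := roumieu_test wM cM r1 l0; have [N0 _ _] := wN.
(* the test functions produce the factor C^|a| on the side of M as well *)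
have hC : 0 < h * C by exact: mulr_gt0.
pose W a := (h * C) ^+ mlength a * N k a.
pose U := open_polar id T W.
have oU : open [set f : beurling_space N | U f].
  exact: (open_polar_beurling wN k0 hC).
have oU' : open [set f : roumieu_space M | U f] by have := (continuousP _).1 cont _ oU.
have [e e0 He] : exists2 e : R, 0 < e & forall a, exists f,
      [/\ roumieu M f, U f & e * C ^+ mlength a * M l a <= monomial_at a (T a) f].
  apply: HT => //; exists 0 => // n.
  by rewrite /monomial_at ComplexField.Normc.normc0 !mul0r.
exists (Num.max 1 e^-1) => [|a]; first by rewrite le_max lexx.
have [f [_ [r r1' Vf] lef]] := He a.
have W0 : 0 < W a by rewrite mulr_gt0 ?exprn_gt0 ?N0.
have WN : e * C ^+ mlength a * M l a <= W a.
  by apply: le_trans lef (le_trans (Vf a) _); rewrite ger_pMl// ltW.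
apply: (@le_trans _ _ (e^-1 * h ^+ mlength a * N k a)); last first.
  rewrite -!mulrA ler_wpM2r ?mulr_ge0 ?exprn_ge0 ?(ltW h0) ?(ltW (N0 _ _ k0))//.
  by rewrite le_max lexx orbT.
rewrite -mulrA ler_pdivlMl//.
rewrite -(ler_pM2l (exprn_gt0 (mlength a) C0)); move: WN; congr (_ <= _).
  by ring.
by rewrite /W exprMn; ring.
Qed.

Lemma continuous_prec_beurling M N (sMN : beurling M `<=` beurling N) :
  weight_matrix M -> weight_matrix N -> log_convex M -> B1 M ->
  continuous (fun f : beurling_space M => BeurlingSpace (sMN f (beurlingP f))) ->
  prec_beurling M N.
Proof.
move=> wM wN cM b1 cont l l0; have [N0 _ _] := wN.
pose W (p : 'rV[nat]_d * 'rV[R]_d) := 1 ^+ mlength p.1 * N l p.1.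
pose U := open_polar fst snd W.
have oU : open [set f : beurling_space N | U f].
  exact: (open_polar_beurling wN l0 ltr01).
have oU' : open [set f : beurling_space M | U f] by have := (continuousP _).1 cont _ oU.
have [k [C [e [k0 C0 e0 He]]]] : exists k C e : R, [/\ 0 < k, 0 < C, 0 < e & forall a, exists t f,
      [/\ beurling M f, U f & e * C ^+ mlength a * M k a <= monomial_at a t f]].
  apply: beurling_test => //; exists 0 => // n.
  by rewrite /monomial_at ComplexField.Normc.normc0 !mul0r.
have Ci : 0 < C^-1 by rewrite invr_gt0.
suff [D D1 HD] : exists2 D, 1 <= D & forall a, M k a <= D ^+ mlength a * N l a.
  by exists k, D.
apply: (@absorb_constant _ _ M N k l e^-1 C^-1) => // a.
have [t [f [_ [r r1 Vf] lef]]] := He a.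
have WN : e * C ^+ mlength a * M k a <= N l a.
  apply: le_trans lef (le_trans (Vf (a, t)) _).
  by rewrite /W expr1n mul1r ger_pMl ?N0// ltW.
rewrite -mulrA ler_pdivlMl// exprVn ler_pdivlMl ?exprn_gt0//.
by move: WN; congr (_ <= _); ring.
Qed.

End necessity.

Theorem theorem6p1 (R : realType) (d : nat) (M N : R -> 'rV[nat]_d -> R)
    (d_gt0 : (0 < d)%N)
    (wM : weight_matrix M) (wN : weight_matrix N) (cM : log_convex M) :
  [/\ R1 M -> R2 M -> R3 M -> R1 N -> R2 N ->
        ((exists sMN : roumieu M `<=` roumieu N,
            continuous (fun f : roumieu_space M =>
              RoumieuSpace (sMN f (roumieuP f)))) <->
         prec_roumieu M N),
      R1 M -> R2 M -> R3 M -> B1 N -> B2 N ->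
        ((exists sMN : roumieu M `<=` beurling N,
            continuous (fun f : roumieu_space M =>
              BeurlingSpace (sMN f (roumieuP f)))) <->
         triangle_prec M N)
    & B1 M -> B2 M -> B3 M -> B1 N -> B2 N ->
        ((exists sMN : beurling M `<=` beurling N,
            continuous (fun f : beurling_space M =>
              BeurlingSpace (sMN f (beurlingP f)))) <->
         prec_beurling M N)].
Proof.
split=> C1 _ _ _ _; split.
- by move=> [sMN]; exact: continuous_prec_roumieu.
- by move=> MN; exact: prec_roumieu_continuous.
- by move=> [sMN]; exact: continuous_triangle_prec.
- by move=> MN; exact: triangle_prec_continuous.
- by move=> [sMN]; exact: continuous_prec_beurling.
- by move=> MN; exact: prec_beurling_continuous.
Qed.
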